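(* (1) Let $m$ be a positive integer and let $\Lambda=(\lambda_{i,j})$ be a nonnegative $d\times n$ table with all entries $\lambda_{i,j}\in\{0,\tfrac1m\}$, total weight $\sum_{i,j}\lambda_{i,j}=n-\tfrac1m$, and at least one zero entry in each row. Then $A=A(\Lambda)$ is a $d$-dimensional extremal matrix of order $n$ with deficiency $\tfrac1m$, and $\Lambda$ is the unique optimal hyperplane cover of $A$. (2) Conversely, if $A$ is a $d$-dimensional extremal matrix of order $n$ having an optimal hyperplane cover $\Lambda$ all of whose entries lie in $\{0,\lambda\}$ for some $\lambda>0$, then $\lambda=\tfrac1m$ for some positive integer $m$, $\Lambda$ has weight $n-\tfrac1m$, and each row of $\Lambda$ contains at least one zero entry (so $A$ and $\Lambda$ are as in part (1)).
   Context: A $d$-dimensional matrix of order $n$ is an array $(a_\alpha)_{\alpha\in\{1,\dots,n\}^d}$; $\mathrm{supp}(A)=\{\alpha:a_\alpha\ne0\}$; the hyperplane $\Gamma_{i,j}$ is the set of indices with $\alpha_i=j$. A polyplex of weight $W$ is a nonnegative matrix $K$ of order $n$ whose entries sum to at most $1$ over each hyperplane and to $W$ in total; a polydiagonal is a polyplex of weight $n$. A $(0,1)$-matrix $A$ contains $K$ if $\mathrm{supp}(K)\subseteq\mathrm{supp}(A)$. A hyperplane cover of $A$ is a nonnegative $d\times n$ table $\Lambda=(\lambda_{i,j})$ with $\sum_{i=1}^d\lambda_{i,\alpha_i}\ge1$ for all $\alpha\in\mathrm{supp}(A)$; its weight is the sum of its entries; it is optimal if it has minimum weight among hyperplane covers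 of $A$. For a nonnegative $d\times n$ table $\Lambda$, $A(\Lambda)$ is the $d$-dimensional $(0,1)$-matrix of order $n$ whose support is $\{\alpha:\sum_{i=1}^d\lambda_{i,\alpha_i}\ge1\}$. A $(0,1)$-matrix $A$ is extremal if it contains no polydiagonal, but for every index $\alpha$ with $a_\alpha=0$ the matrix obtained by changing $a_\alpha$ to $1$ contains a polydiagonal. The deficiency of an extremal matrix of order $n$ is $n$ minus the maximum weight of a polyplex contained in it.
   Formalization: In part (2), λ = 1/m is asserted only for n > 1: for n = 1 the zero matrix is extremal with optimal cover Λ = 0, so λ is arbitrary; there the theorem still gives an m with entries in {0, 1/m}, weight n − 1/m and a zero in each row. *)

(* Defs.v *)
From mathcomp Require Import all_boot all_order all_algebra.
Set Implicit Arguments.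
Unset Strict Implicit.
Unset Printing Implicit Defensive.
Import Order.TTheory GRing.Theory Num.Theory.
Local Open Scope ring_scope.

(* 'I_n = {0, ..., n-1} stands for {1, ..., n}, and likewise 'I_d for the
   d directions. *)
Definition index (d n : nat) := {ffun 'I_d -> 'I_n}.

Definition dmatrix (T : Type) (d n : nat) := {ffun index d n -> T}.

(* A (0,1)-matrix has boolean entries: true is 1 and false is 0. *)
Definition zero_one_matrix (d n : nat) := dmatrix bool d n.

Definition supp (R : realFieldType) d n (K : dmatrix R d n) : {set index d n} :=
  [set a | K a != 0].

Definition supp01 d n (A : zero_one_matrix d n) : {set index d n} :=
  [set a | A a].

Definition hyperplane d n (i : 'I_d) (j : 'I_n) : {set index d n} :=
  [set a : index d n | a i == j].

Definition polyplex (R : realFieldType) d n (W : R) (K : dmatrix R d n) : Prop :=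
  [/\ forall a, 0 <= K a,
      forall (i : 'I_d) (j : 'I_n), \sum_(a in hyperplane i j) K a <= 1
    & \sum_a K a = W].

Definition polydiagonal (R : realFieldType) d n (K : dmatrix R d n) : Prop :=
  polyplex n%:R K.

Definition contains (R : realFieldType) d n
    (A : zero_one_matrix d n) (K : dmatrix R d n) : Prop :=
  supp K \subset supp01 A.

Definition contains_polydiagonal (R : realFieldType) d n
    (A : zero_one_matrix d n) : Prop :=
  exists K : dmatrix R d n, polydiagonal K /\ contains A K.

Definition nonneg_table (R : realFieldType) d n (L : 'M[R]_(d, n)) : Prop :=
  forall i j, 0 <= L i j.

Definition table_weight (R : realFieldType) d n (L : 'M[R]_(d, n)) : R :=
  \sum_(i < d) \sum_(j < n) L i j.

Definition hyperplane_cover (R : realFieldType) d n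
    (A : zero_one_matrix d n) (L : 'M[R]_(d, n)) : Prop :=
  nonneg_table L /\
  forall a, a \in supp01 A -> 1 <= \sum_(i < d) L i (a i).

Definition optimal_cover (R : realFieldType) d n
    (A : zero_one_matrix d n) (L : 'M[R]_(d, n)) : Prop :=
  hyperplane_cover A L /\
  forall L' : 'M[R]_(d, n),
    hyperplane_cover A L' -> table_weight L <= table_weight L'.

Definition matrix_of_table (R : realFieldType) d n (L : 'M[R]_(d, n)) :
    zero_one_matrix d n :=
  [ffun a : index d n => 1 <= \sum_(i < d) L i (a i)].

Definition set_one d n (A : zero_one_matrix d n) (a : index d n) :
    zero_one_matrix d n :=
  [ffun b => (b == a) || A b].

Definition extremal (R : realFieldType) d n (A : zero_one_matrix d n) : Prop :=
  ~ contains_polydiagonal R A /\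
  forall a, A a = false -> contains_polydiagonal R (set_one A a).

Definition max_polyplex_weight (R : realFieldType) d n
    (A : zero_one_matrix d n) (W : R) : Prop :=
  (exists K : dmatrix R d n, polyplex W K /\ contains A K) /\
  forall (W' : R) (K : dmatrix R d n),
    polyplex W' K -> contains A K -> W' <= W.

(* The deficiency as a relation; the maximum weight is unique when it exists. *)
Definition has_deficiency (R : realFieldType) d n
    (A : zero_one_matrix d n) (delta : R) : Prop :=
  exists W : R, max_polyplex_weight A W /\ delta = n%:R - W.

(* Main.v *)
(* A polydiagonal has all its hyperplane sums equal to 1, so pairing it with a
   table L shows that a cover of a matrix containing a polydiagonal has weight
   at least n. If the polydiagonal K uses one extra position a outside the
   matrix, a cover L of the matrix satisfies
     weight L >= n - K a * (1 - L-weight of a),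
   and both parts are obtained by choosing a well.

   (1) Let the support of L be S. An index of A(L) has at least m coordinates in
   S. If a has t < m such coordinates, there is a polydiagonal K in A(L) + a
   with K a = 1/(m - t), supported otherwise on indices with exactly m
   coordinates in S. For a cover L' this gives, with t = 0, the optimality of L
   and the polyplex of weight n - 1/m, and with t <= 1, L' <= L as soon as L' is
   optimal and m > 1.

   (2) By Farkas' lemma a matrix without polydiagonal has a cover of weight
   less than n, which gives A = A(L). Let m be the least number of coordinates
   in S of an index of A. Comparing L with the tables obtained by putting 1/m on
   S, or 1/(m - 1) on S minus a full row, yields lambda = 1/m and a zero in
   each row; an index with exactly m - 1 coordinates in S then forces the
   weight to be at least n - 1/m. *)
Require Import Defs.
From mathcomp Require Import all_boot all_order all_algebra.
From mathcomp Require Import lra zify.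
Set Implicit Arguments.
Unset Strict Implicit.
Unset Printing Implicit Defensive.
Import Order.TTheory GRing.Theory Num.Theory.
Local Open Scope ring_scope.

(** * Farkas' lemma *)

(* Induction on the number of rows: a point that satisfies all the inequalities
   but the first one serves to eliminate the first row (Bartl). *)
Lemma farkas (R : realFieldType) (k N : nat) (A : 'M[R]_(k, N)) (g : 'rV[R]_N) :
  (exists x : 'cV[R]_N, (forall i, (A *m x) i 0 <= 0) /\ 0 < (g *m x) 0 0) \/
  (exists c : 'rV[R]_k, (forall i, 0 <= c 0 i) /\ c *m A = g).
Proof.
elim: k A g => [|k IHk] A g.
  have [->|gN0] := eqVneq g 0.
    by right; exists 0; split=> [[]//|]; rewrite mul0mx.
  left; exists g^T; split=> [[]//|].
  rewrite mxE; under eq_bigr => j _ do rewrite mxE -expr2.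
  rewrite lt_neqAle sumr_ge0 ?andbT => [|j _]; last exact: sqr_ge0.
  apply: contra gN0; rewrite eq_sym psumr_eq0 => [/allP g0|j _]; last first.
    exact: sqr_ge0.
  apply/eqP/rowP => j; rewrite mxE; apply/eqP.
  by rewrite -sqrf_eq0; apply: g0; rewrite mem_index_enum.
pose f := usubmx (A : 'M_(1 + k, N)); pose B := dsubmx (A : 'M_(1 + k, N)).
have defA : A = col_mx f B by rewrite vsubmxK.
have [[x0 [Bx0 gx0]]|[c [c_ge0 cB]]] := IHk B g; last first.
  right; exists (row_mx (0 : 'rV_1) c); split=> [i|].
    rewrite mxE; case: splitP => j _; [by rewrite mxE | exact: c_ge0].
  by rewrite defA (mul_row_col (0 : 'rV_1)) mul0mx add0r.
have [fx0_le0|fx0_gt0] := lerP ((f *m x0) 0 0) 0.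
  left; exists x0; split=> // i; rewrite defA (mul_col_mx f B) mxE.
  by case: splitP => j _; [rewrite (ord1 j) | apply: Bx0].
pose x1 := ((f *m x0) 0 0)^-1 *: x0.
have fx1 : f *m x1 = 1%:M.
  rewrite -scalemxAr; apply/matrixP => i j; rewrite !ord1 !mxE /= mulVf //.
  by rewrite gt_eqF //; move: fx0_gt0; rewrite mxE.
have Bx1 i : (B *m x1) i 0 <= 0.
  rewrite -scalemxAr mxE mulr_ge0_le0 ?Bx0 //.
  by rewrite invr_ge0 ltW.
have gx1 : 0 < (g *m x1) 0 0.
  by rewrite -scalemxAr mxE mulr_gt0 ?invr_gt0.
(* The map sending [x] to [x - x1 *m (f *m x)] projects onto the kernel of [f] along [x1]; the
   induction hypothesis is applied to [B] and [g] composed with it. *)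
have [[x [Bx gx]]|[c [c_ge0 cB]]] := IHk (B - B *m x1 *m f) (g - g *m x1 *m f).
  left; exists (x - x1 *m (f *m x)); split=> [i|].
    have -> : A *m (x - x1 *m (f *m x))
        = col_mx (0 : 'M_1) ((B - B *m x1 *m f) *m x).
      rewrite defA (mul_col_mx f B) !mulmxBr !mulmxBl !mulmxA.
      by rewrite fx1 mul1mx subrr.
    by rewrite mxE; case: splitP => j _; [rewrite mxE | apply: Bx].
  by move: gx; rewrite mulmxBl mulmxBr !mulmxA.
(* The new coefficient is nonnegative because at [x1] the form [g] is positive and all rows of [B]
   are nonpositive. *)
right; exists (row_mx (g *m x1 - c *m B *m x1) c); split=> [i|].
  rewrite mxE; case: splitP => j _; last exact: c_ge0.
  rewrite ord1 mxE [X in _ + X]mxE subr_ge0 (le_trans _ (ltW gx1)) //.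
  rewrite -mulmxA mxE sumr_le0 // => l _.
  by rewrite mulr_ge0_le0 ?c_ge0 ?Bx1.
rewrite defA (mul_row_col _ c f) mulmxBl; move/eqP: cB.
rewrite mulmxBr !mulmxA subr_eq => /eqP cB.
by rewrite [X in _ + X]cB addrACA addNr addr0 addrC subrK.
Qed.

(** * Counting tools: cyclic arcs and prescribed fibres *)

(** Passing from [c] to [c.+1] trades the term [c %/ N] for [(c + N) %/ N], which is larger by
    one. *)
Lemma hermite_identity (N c : nat) :
  (0 < N)%N -> (\sum_(r < N) (c + r) %/ N = c)%N.
Proof.
move=> N_gt0; elim: c => [|c IHc].
  by apply: big1 => r _; rewrite add0n divn_small.
have H : (\sum_(r < N) (c + r) %/ N + (c + N) %/ N
   = c %/ N + \sum_(r < N) (c.+1 + r) %/ N)%N.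
  rewrite -(big_ord_recr N (fun r => (c + r) %/ N)%N) big_ord_recl addn0.
  by congr addn; apply: eq_bigr => r _; rewrite /bump /= addnA addn1.
move/eqP: H.
by rewrite IHc divnDr // divnn N_gt0 addnCA eqn_add2l addn1 => /eqP <-.
Qed.

(* Systematic sampling: lay arcs of lengths [k i] end to end around a cycle of
   length [N]; after [m] full turns each point is covered [m] times. Up to
   reversing the cycle, [(x + r) %/ N] counts the visits of [r] before time
   [x]. *)
Lemma balanced_arcs (d N m : nat) (k : 'I_d -> nat) :
  (forall i, k i <= N)%N -> (\sum_i k i = m * N)%N ->
  exists B : 'I_d -> {set 'I_N},
    (forall i, #|B i| = k i) /\
    (forall r, \sum_i (r \in B i) = m)%N.
Proof.
case: N => [|N] k_le sum_k.
  exists (fun=> set0); split=> [i|[]//].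
  by rewrite cards0; apply/esym/eqP; rewrite -leqn0.
pose c j := (\sum_(i < d | i < j) k i)%N.
have cS (i : 'I_d) : c i.+1 = (c i + k i)%N.
  rewrite /c (bigD1 i) //= addnC; congr addn.
  apply: eq_bigl => l.
  by rewrite ltnS ltn_neqAle andbC.
pose u (r : 'I_N.+1) j := ((c j + r) %/ N.+1)%N.
have uS r (i : 'I_d) : (u r i <= u r i.+1 <= (u r i).+1)%N.
  rewrite /u cS leq_div2r /=; last by lia.
  have : (c i + k i + r <= c i + r + N.+1)%N by rewrite addnAC leq_add2l.
  by move/(leq_div2r N.+1); rewrite (divnDr _ (dvdnn _)) divnn addn1.
have step x y : (x <= y <= x.+1 -> x + (x < y) = y)%N.
  by case/andP; case: ltngtP => //=; lia.
(* Since [k i <= N.+1], arc [i] visits [r] at most once; [B i] collects the points whose count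
   rises. *)
exists (fun i => [set r | u r i < u r i.+1]%N); split=> [i|r].
  rewrite -sum1_card big_mkcond /=.
  (* By [hermite_identity] the counts at time [c j] add up to [c j], so [B i] has [c i.+1 - c i]
     points. *)
  have H : (\sum_r u r i
      + \sum_r (if r \in [set r | u r i < u r i.+1] then 1 else 0)
      = \sum_r u r i.+1)%N.
    rewrite -big_split; apply: eq_bigr => r _; rewrite inE.
    by rewrite -[RHS](step _ _ (uS r i)); case: ltnP.
  by move: H; rewrite /u !hermite_identity // cS => /addnI.
transitivity (\sum_(i < d) (u r i.+1 - u r i))%N.
  apply: eq_bigr => i _; rewrite inE.
  by rewrite -[X in (X - _)%N](step _ _ (uS r i)) addKn.
rewrite -(big_mkord xpredT (fun i => u r i.+1 - u r i)%N) telescope_sumn_in //.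
  have -> : u r d = (m + r %/ N.+1)%N.
    rewrite -divnMDl // -sum_k /u /c; congr ((_ + _) %/ _)%N.
    by apply: eq_bigl => i; rewrite ltn_ord.
  have -> : u r 0%N = (r %/ N.+1)%N by rewrite /u /c big_pred0.
  by rewrite addnK.
by move=> i /andP[_ id]; case/andP: (uS r (Ordinal id)).
Qed.

(** The list with each [j] of [P] repeated [mu j] times is as long as [enum B], and [f] matches the
    two position by position; outside [B] it takes the default [j0]. *)
Lemma prescribed_fibres (T J : finType) (B : {set T}) (P : pred J)
    (mu : J -> nat) (j0 : J) :
  (\sum_(j | P j) mu j = #|B|)%N ->
  exists f : T -> J,
    (forall x, x \in B -> P (f x)) /\
    (forall j, P j -> #|[set x in B | f x == j]| = mu j).
Proof.
move=> sum_mu; pose s := flatten [seq nseq (mu j) j | j <- enum P].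
have size_s : size s = #|B|.
  rewrite size_flatten /shape -map_comp sumnE big_map -sum_mu big_enum /=.
  by apply: eq_bigr => j _; rewrite size_nseq.
pose f x := nth j0 s (index x (enum B)).
have f_s : map f (enum B) = s.
  apply: (@eq_from_nth _ j0); rewrite size_map -cardE ?size_s // => i iB.
  have x0 : T by case: (enum B) iB (cardE B) => [|x //] ; move=> + e; rewrite e.
  by rewrite (nth_map x0) -?cardE // /f index_uniq ?enum_uniq -?cardE.
exists f; split=> [x xB|j Pj].
  have : f x \in s by rewrite -f_s map_f ?mem_enum.
  case/flattenP=> _ /mapP[j jP ->].
  by rewrite mem_nseq mem_enum in jP * => /andP[_ /eqP->].
rewrite cardE -(_ : count_mem j s = mu j).
  rewrite -f_s count_map -size_filter; apply/perm_size/uniq_perm => [||x].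
  - exact: enum_uniq.
  - exact/filter_uniq/enum_uniq.
  by rewrite mem_filter !mem_enum inE andbC.
rewrite count_flatten -map_comp sumnE big_map big_enum /= (bigD1 j) //=.
rewrite count_nseq /= eqxx mul1n big1 ?addn0 // => l /andP[_ /negPf lj].
by rewrite count_nseq /= lj.
Qed.

(** * Pairing polyplexes with tables: weak duality *)

Definition index_weight (R : realFieldType) d n (L : 'M[R]_(d, n))
  (a : Defs.index d n) : R := \sum_(i < d) L i (a i).

Lemma entry_le_table_weight (R : realFieldType) d n (L : 'M[R]_(d, n)) i j :
  nonneg_table L -> L i j <= table_weight L.
Proof.
move=> L_ge0; rewrite /table_weight (bigD1 i) //= (bigD1 j) //= -addrA lerDl.
by apply: addr_ge0; do ?[apply: sumr_ge0 => ? _]; apply: L_ge0.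
Qed.

Lemma mxvec_dot (R : realFieldType) d n (A X : 'M[R]_(d, n)) :
  (mxvec A *m (mxvec X)^T) 0 0 = \sum_i \sum_j A i j * X i j.
Proof.
rewrite mxE (reindex _ (curry_mxvec_bij _ _)) pair_bigA /=.
by apply: eq_bigr => -[i j] _ /=; rewrite mxE !mxvecE.
Qed.

Lemma sum_hyperplane (R : realFieldType) d n (K : dmatrix R d n) i j :
  \sum_(a in hyperplane i j) K a = \sum_a K a * (a i == j)%:R.
Proof.
rewrite big_mkcond; apply: eq_bigr => a _.
by rewrite inE; case: eqP; rewrite ?mulr1 ?mulr0.
Qed.

Lemma sum_indicator (R : realFieldType) n (F : 'I_n -> R) (j : 'I_n) :
  \sum_l (j == l)%:R * F l = F j.
Proof.
rewrite (bigD1 j) //= eqxx mul1r big1 ?addr0 // => l /negPf jl.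
by rewrite eq_sym jl mul0r.
Qed.

Lemma sum_index_weight (R : realFieldType) d n (K : dmatrix R d n)
    (L : 'M[R]_(d, n)) :
  \sum_a K a * index_weight L a =
  \sum_i \sum_j (\sum_(a in hyperplane i j) K a) * L i j.
Proof.
under eq_bigr do rewrite mulr_sumr.
rewrite exchange_big; apply: eq_bigr => i _ /=.
under [RHS]eq_bigr do rewrite sum_hyperplane mulr_suml.
rewrite [RHS]exchange_big; apply: eq_bigr => a _ /=.
by under eq_bigr do rewrite -mulrA; rewrite -mulr_sumr sum_indicator.
Qed.

Lemma sum_hyperplanes (R : realFieldType) d n (K : dmatrix R d n) (i : 'I_d) :
  \sum_j \sum_(a in hyperplane i j) K a = \sum_a K a.
Proof.
under eq_bigr do rewrite sum_hyperplane.
rewrite exchange_big; apply: eq_bigr => a _ /=.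
by under eq_bigr do rewrite mulrC; rewrite sum_indicator.
Qed.

Lemma sum_index_weight_le (R : realFieldType) d n (W : R) (K : dmatrix R d n)
    (L : 'M[R]_(d, n)) :
  polyplex W K -> nonneg_table L ->
  \sum_a K a * index_weight L a <= table_weight L.
Proof.
move=> [_ K_le1 _] L_ge0; rewrite sum_index_weight.
by do 2![apply: ler_sum => ? _]; rewrite ler_piMl.
Qed.

(** Weak linear programming duality: every index in the support of [K] has weight at least 1 in
    [L]. *)
Lemma polyplex_le_table_weight (R : realFieldType) d n (A : zero_one_matrix d n)
    (W : R) (K : dmatrix R d n) (L : 'M[R]_(d, n)) :
  polyplex W K -> contains A K -> hyperplane_cover A L -> W <= table_weight L.
Proof.
move=> KW /subsetP AK [L_ge0 AL].
apply: le_trans (sum_index_weight_le KW L_ge0).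
have [K_ge0 _ <-] := KW; apply: ler_sum => a _.
have [->|Ka0] := eqVneq (K a) 0; first by rewrite mul0r.
by rewrite ler_peMr //; apply/AL/AK; rewrite inE.
Qed.

Lemma polydiagonal_slack (R : realFieldType) d n (A : zero_one_matrix d n)
    (a : Defs.index d n) (K : dmatrix R d n) (L : 'M[R]_(d, n)) :
  polydiagonal K -> contains (set_one A a) K -> hyperplane_cover A L ->
  n%:R - K a * (1 - index_weight L a) <= table_weight L.
Proof.
move=> Kdiag /subsetP AK [L_ge0 AL].
apply: le_trans (sum_index_weight_le Kdiag L_ge0).
have [K_ge0 _ <-] := Kdiag.
rewrite (bigD1 a) //= [leRHS](bigD1 a) //=.
suff : \sum_(b | b != a) K b <= \sum_(b | b != a) K b * index_weight L b.
  by lra.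
apply: ler_sum => b ba; have [->|Kb0] := eqVneq (K b) 0; first by rewrite mul0r.
rewrite ler_peMr //; apply: AL.
by have := AK b; rewrite !inE ffunE (negPf ba); apply.
Qed.

Lemma polyplex_entry_le1 (R : realFieldType) d n (W : R) (K : dmatrix R d n) a :
  (0 < d)%N -> polyplex W K -> K a <= 1.
Proof.
move=> d_gt0 [K_ge0 K_le1 _]; apply: le_trans (K_le1 (Ordinal d_gt0) (a _)).
by rewrite (bigD1 a) ?inE //= lerDl sumr_ge0.
Qed.

(** * Strong duality for polydiagonals *)

(* The Farkas certificate [y] need not be nonnegative: the cover is the constant
   table [1 / d], of weight [n], perturbed in the direction [- y]. *)
Lemma polydiagonal_or_light_cover (R : realFieldType) d n
    (A : zero_one_matrix d n) :
  (0 < d)%N ->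
  contains_polydiagonal R A \/
  exists L : 'M[R]_(d, n), hyperplane_cover A L /\ table_weight L < n%:R.
Proof.
move=> d_gt0.
(* The equation [c *m F = mxvec (const_mx 1)] says that [c], restricted to the support of [A], has
   all hyperplane sums 1; indices outside [A] give zero rows. *)
pose E a : 'M[R]_(d, n) := \matrix_(i, j) (A a && (a i == j))%:R.
pose F : 'M[R]_(#|Defs.index d n|, d * n) := \matrix_r mxvec (E (enum_val r)).
have [[x [Fx gx]]|[c [c_ge0 cF]]] := farkas F (mxvec (const_mx 1)).
- right; pose y : 'M[R]_(d, n) := vec_mx x^T.
  have xE : x = (mxvec y)^T by rewrite vec_mxK trmxK.
  have y_pos : 0 < table_weight y.
    move: gx; rewrite xE mxvec_dot /table_weight.
    by under eq_bigr do under eq_bigr do rewrite mxE mul1r.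
  have y_neg a : A a -> index_weight y a <= 0.
    move=> Aa; have := Fx (enum_rank a).
    have -> : (F *m x) (enum_rank a) 0 = (row (enum_rank a) F *m x) 0 0.
      by rewrite -row_mul [RHS]mxE.
    rewrite rowK enum_rankK xE mxvec_dot; congr (_ <= _).
    apply: eq_bigr => i _; under eq_bigr do rewrite mxE Aa /=.
    by rewrite sum_indicator.
  have ny_ge0 : nonneg_table (\matrix_(i, j) `|y i j|) by move=> i j; rewrite mxE.
  pose M := table_weight (\matrix_(i, j) `|y i j|).
  have yM i j : y i j <= M.
    apply: le_trans (entry_le_table_weight i j ny_ge0).
    by rewrite [leRHS]mxE ler_norm.
  have M_ge0 : 0 <= M by do 2![apply: sumr_ge0 => ? _]; apply: ny_ge0.
  (* [M + 1] is positive and bounds every entry of [y], so [e * y i j] is at most [1 / d]. *)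
  pose e := (M + 1)^-1 / d%:R.
  have d_pos : 0 < d%:R :> R by rewrite ltr0n.
  have e_gt0 : 0 < e by rewrite divr_gt0 // invr_gt0 ltr_wpDl.
  have wE a : index_weight (\matrix_(i, j) (d%:R^-1 - e * y i j)) a
      = 1 - e * index_weight y a.
    rewrite /index_weight; under eq_bigr do rewrite mxE.
    rewrite sumrB sumr_const card_ord -(mulr_natl d%:R^-1) mulfV ?gt_eqF //.
    by rewrite mulr_sumr.
  exists (\matrix_(i, j) (d%:R^-1 - e * y i j)); split; [split|].
  + move=> i j; rewrite mxE subr_ge0 /e mulrAC -[leRHS]mul1r.
    rewrite ler_wpM2r ?invr_ge0 ?ler0n // ler_pdivrMl ?ltr_wpDl // mulr1.
    by rewrite (le_trans (yM i j)) // lerDl.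
  + move=> a; rewrite inE => /y_neg ya; rewrite [leRHS]wE lerDl oppr_ge0.
    by rewrite mulr_ge0_le0 // ltW.
  rewrite /table_weight; under eq_bigr do under eq_bigr do rewrite mxE.
  under eq_bigr do rewrite sumrB sumr_const card_ord -mulr_sumr.
  rewrite sumrB -mulr_sumr sumr_const card_ord -mulrnA mulnC mulrnA.
  by rewrite -(mulr_natl d%:R^-1) mulfV ?gt_eqF // ltrBlDr ltrDl mulr_gt0.
(* The coefficients of the zero rows need not vanish, hence the mask by [A]. *)
left; pose K : dmatrix R d n := [ffun a => if A a then c 0 (enum_rank a) else 0].
have K_hyp i j : \sum_(a in hyperplane i j) K a = 1.
  have := congr1 (fun v : 'rV_(d * n) => vec_mx v i j) cF.
  rewrite mxvecK [in RHS]mxE => <-; rewrite sum_hyperplane !mxE.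
  rewrite [LHS](reindex (@enum_val (Defs.index d n) predT)) /=; last first.
    exact/onW_bij/enum_val_bij.
  apply: eq_bigr => r _; rewrite ffunE enum_valK.
  have -> : F r (mxvec_index i j) = E (enum_val r) i j.
    by rewrite mxE mxvecE.
  by rewrite mxE; case: (A _) => //=; rewrite mul0r mulr0.
exists K; split; [split|].
- by move=> a; rewrite ffunE; case: ifP.
- by move=> i j; rewrite K_hyp.
- rewrite -(sum_hyperplanes K (Ordinal d_gt0)).
  by under eq_bigr do rewrite K_hyp; rewrite sumr_const card_ord.
by apply/subsetP => a; rewrite !inE ffunE; case: ifP; rewrite ?eqxx.
Qed.

(** * Polydiagonals through a prescribed index *)

(* [a] and the indices [f r] together meet each hyperplane [m - t] times, which
   is why [f] has one index less than [(m - t) * n]. *)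
Lemma level_selection (d n m t : nat) (S : 'I_d -> pred 'I_n)
    (a : Defs.index d n) :
  ((\sum_i \sum_j S i j).+1 = m * n)%N ->
  (\sum_i S i (a i))%N = t -> (t < m)%N ->
  exists f : 'I_((m - t) * n).-1 -> Defs.index d n,
    (forall r, \sum_i S i (f r i) = m)%N /\
    (forall i j, #|[set r | f r i == j]| + (a i == j) = m - t)%N.
Proof.
move=> sum_S sum_a t_lt; set M := (m - t)%N; set N := (M * n).-1.
(* The required number of [r] with [f r i = j]. *)
pose mu i j := (M - (a i == j))%N.
have M_gt0 : (0 < M)%N by rewrite subn_gt0.
have muE i j : (mu i j + (a i == j) = M)%N.
  by rewrite subnK //; case: (_ == _).
have sum_mu i (P : pred 'I_n) :
    (\sum_(j | P j) mu i j + P (a i) = M * \sum_j P j)%N.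
  have -> : (P (a i) = \sum_(j | P j) (a i == j) :> nat)%N.
    rewrite big_mkcond (bigD1 (a i)) //= eqxx big1 ?addn0; first by case: (P _).
    by move=> j /negPf ja; rewrite eq_sym ja; case: (P _).
  rewrite -big_split /= big_distrr big_mkcond /=; apply: eq_bigr => j _.
  by case: (P j); rewrite ?muln0 ?muln1.
have n_gt0 : (0 < n)%N.
  by have := ltn0Sn (\sum_i \sum_j S i j); rewrite sum_S muln_gt0 => /andP[].
have all_mu i : (\sum_j mu i j = N)%N.
  rewrite /N -[n in (M * n)%N]card_ord -sum1_card.
  by rewrite -(sum_mu i xpredT) addn1; apply: eq_bigl.
have split_mu i (P : pred 'I_n) :
    (\sum_(j | P j) mu i j + \sum_(j | ~~ P j) mu i j = N)%N.
  by rewrite -(all_mu i) [RHS](bigID P).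
have k_le i : (\sum_(j | S i j) mu i j <= N)%N.
  by rewrite -(split_mu i (S i)) leq_addr.
(* The value of [M] matters here: [M * (m * n - 1) - t] equals [m * (M * n - 1)] because
   [M + t = m]. *)
have sum_k : (\sum_i \sum_(j | S i j) mu i j = m * N)%N.
  have : (\sum_i \sum_(j | S i j) mu i j + t = M * \sum_i \sum_j S i j)%N.
    rewrite -sum_a -big_split big_distrr; apply: eq_bigr => i _ /=.
    exact: sum_mu.
  have : (M * (\sum_i \sum_j S i j).+1 = m * (M * n))%N by rewrite sum_S mulnCA.
  have : (N.+1 = M * n)%N by rewrite prednK // muln_gt0 M_gt0.
  move=> <-; rewrite !mulnS /M; lia.
(* The arcs decide in which directions [f r] has its coordinate in [S]; the coordinates inside and
   outside [S] are then dealt out with fibre sizes [mu]. *)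
have [B [cardB cover_B]] := balanced_arcs k_le sum_k.
have /fin_all_exists[g gP] i : exists g : 'I_N -> 'I_n,
    (forall r, S i (g r) = (r \in B i)) /\
    (forall j, #|[set r | g r == j]| = mu i j).
  have cardBC : (\sum_(j | ~~ S i j) mu i j = #|~: B i|)%N.
    apply/eqP; rewrite -(eqn_add2l #|B i|) cardsC card_ord cardB.
    by rewrite split_mu.
  have [g1 [g1S g1mu]] := prescribed_fibres (a i) (esym (cardB i)).
  have [g2 [g2S g2mu]] := prescribed_fibres (P := predC (S i)) (a i) cardBC.
  exists (fun r => if r \in B i then g1 r else g2 r); split=> [r|j].
    case: ifPn => [/g1S //|rB]; apply/negbTE/g2S.
    by rewrite inE.
  have [Sj|nSj] := boolP (S i j).
    rewrite -g1mu //; apply: eq_card => r; rewrite !inE.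
    case: ifPn => //= rB; apply: contraTF Sj => /eqP <-.
    by apply: g2S; rewrite inE.
  rewrite -g2mu //; apply: eq_card => r; rewrite !inE.
  by case: ifPn => //= rB; apply: contraNF nSj => /eqP <-; apply: g1S.
exists (fun r => [ffun i => g i r]); split=> [r|i j].
  rewrite -(cover_B r); apply: eq_bigr => i _; rewrite ffunE.
  by case: (gP i) => ->.
rewrite -(muE i j) -(proj2 (gP i)); congr (_ + _)%N.
by apply: eq_card => r; rewrite !inE ffunE.
Qed.

Definition two_valued_table (R : realFieldType) d n (lambda : R)
    (S : 'I_d -> pred 'I_n) : 'M[R]_(d, n) :=
  \matrix_(i, j) (lambda *+ S i j).

Section TwoValuedTable.
Variables (R : realFieldType) (d n : nat) (S : 'I_d -> pred 'I_n).

Lemma two_valued_weight (lambda : R) :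
  table_weight (two_valued_table lambda S) = lambda *+ (\sum_i \sum_j S i j).
Proof.
rewrite -sumrMnr; apply: eq_bigr => i _; rewrite -sumrMnr.
by apply: eq_bigr => j _; rewrite mxE.
Qed.

Lemma two_valued_index_weight (lambda : R) (a : Defs.index d n) :
  index_weight (two_valued_table lambda S) a = lambda *+ (\sum_i S i (a i)).
Proof. by rewrite -sumrMnr; apply: eq_bigr => i _; rewrite mxE. Qed.

Lemma two_valued_nonneg (lambda : R) :
  0 <= lambda -> nonneg_table (two_valued_table lambda S).
Proof. by move=> l_ge0 i j; rewrite mxE mulrn_wge0. Qed.

Lemma invr_mulrn_ge1 (m c : nat) :
  (0 < m)%N -> (1 <= (m%:R^-1 : R) *+ c) = (m <= c)%N.
Proof.
move=> m_gt0; rewrite -(mulr_natl _^-1) ler_pdivlMr ?ltr0n //.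
by rewrite mul1r ler_nat.
Qed.

Lemma matrix_of_two_valued (m : nat) (a : Defs.index d n) :
  (0 < m)%N ->
  matrix_of_table (two_valued_table (m%:R^-1 : R) S) a
  = (m <= \sum_i S i (a i))%N.
Proof.
move=> m_gt0; rewrite ffunE -(invr_mulrn_ge1 _ m_gt0).
by rewrite -two_valued_index_weight.
Qed.

Lemma two_valued_cover (A : zero_one_matrix d n) (m : nat) :
  (0 < m)%N -> (forall a, A a -> (m <= \sum_i S i (a i))%N) ->
  hyperplane_cover A (two_valued_table (m%:R^-1 : R) S).
Proof.
move=> m_gt0 AS; split=> [|a].
  by apply: two_valued_nonneg; rewrite invr_ge0 ler0n.
by rewrite inE => /AS; rewrite -(matrix_of_two_valued a m_gt0) ffunE.
Qed.

(** [K] counts multiplicities among [a] and the selected indices, divided by [m - t]. Selected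
    indices have [m] coordinates in [S] and [a] has fewer, so [a] is counted once. *)
Lemma polydiagonal_through (m t : nat) (a : Defs.index d n) :
  (0 < d)%N -> ((\sum_i \sum_j S i j).+1 = m * n)%N ->
  (\sum_i S i (a i))%N = t -> (t < m)%N ->
  exists K : dmatrix R d n,
    [/\ polydiagonal K,
        contains
          (set_one (matrix_of_table (two_valued_table (m%:R^-1 : R) S)) a) K
      & K a = (m - t)%:R^-1].
Proof.
move=> d_gt0 sum_S sum_a t_lt.
have [f [f_level f_fibre]] := level_selection sum_S sum_a t_lt.
have M_neq0 : (m - t)%:R != 0 :> R by rewrite pnatr_eq0 -lt0n subn_gt0.
pose K : dmatrix R d n :=
  [ffun b => (#|[set r | f r == b]| + (b == a))%:R / (m - t)%:R].
have K_hyp i j : \sum_(b in hyperplane i j) K b = 1.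
  under eq_bigr do rewrite ffunE.
  rewrite -mulr_suml -natr_sum big_split /=.
  rewrite -[RHS](mulfV M_neq0); congr (_%:R / _).
  rewrite -[RHS](f_fibre i j); congr (_ + _)%N.
    rewrite -sum1dep_card (partition_big f (mem (hyperplane i j))) => [|r].
      apply: eq_bigr => b; rewrite inE -sum1dep_card => /eqP bj.
      by apply: eq_bigl => r; case: eqP => [->|]; rewrite ?bj ?eqxx ?andbF.
    by rewrite !inE.
  rewrite big_mkcond (bigD1 a) //= eqxx inE big1 => [|b /negPf ->].
    by rewrite addn0; case: ifP.
  by case: ifP.
exists K; split.
- split=> [b|i j|].
  + by rewrite ffunE divr_ge0 ?ler0n.
  + by rewrite K_hyp.
  rewrite -(sum_hyperplanes K (Ordinal d_gt0)).
  by under eq_bigr do rewrite K_hyp; rewrite sumr_const card_ord.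
- have m_gt0 : (0 < m)%N by apply: leq_ltn_trans t_lt.
  apply/subsetP => b; rewrite !inE !ffunE /=; case: (eqVneq b a) => //= _.
  apply: contraNT => nAb; rewrite addn0.
  have -> : [set r | f r == b] = set0; last by rewrite cards0 mul0r.
  apply/setP => r; rewrite !inE; apply: contraNF nAb => /eqP <-.
  by have := matrix_of_two_valued (f r) m_gt0; rewrite f_level leqnn ffunE.
rewrite ffunE eqxx.
have -> : [set r | f r == a] = set0; last by rewrite cards0 mul1r.
apply/setP => r; rewrite !inE; apply/eqP => fa.
by move: (f_level r) t_lt; rewrite fa sum_a => ->; rewrite ltnn.
Qed.

End TwoValuedTable.

(** * Changing one coordinate, and comparing tables *)

Definition update d n (a : Defs.index d n) (i : 'I_d) (j : 'I_n) :
    Defs.index d n := [ffun l => if l == i then j else a l].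

(** The general operation serves both counts in [nat] and weights in [R]. *)
Lemma big_update (T : Type) (idx : T) (op : Monoid.com_law idx) d n
    (F : 'I_d -> 'I_n -> T) (a : Defs.index d n) i j :
  \big[op/idx]_l F l (update a i j l)
  = op (F i j) (\big[op/idx]_(l | l != i) F l (a l)).
Proof.
rewrite (bigD1 i) //= ffunE eqxx; congr (op _ _).
by apply: eq_bigr => l /negPf li; rewrite ffunE li.
Qed.

(** Each entry of the nonnegative table [Y - X] is at most its total weight, which is at most 0. *)
Lemma table_eq_of_le (R : realFieldType) d n (X Y : 'M[R]_(d, n)) :
  (forall i j, X i j <= Y i j) -> table_weight Y <= table_weight X -> X = Y.
Proof.
move=> XY YX; apply/matrixP => i j; apply/eqP; rewrite eq_le XY /=.
have YX_ge0 : nonneg_table (Y - X) by move=> k l; rewrite !mxE subr_ge0.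
have := entry_le_table_weight i j YX_ge0; rewrite !mxE lerBlDr.
suff -> : table_weight (Y - X) = table_weight Y - table_weight X by lra.
rewrite /table_weight -sumrB; apply: eq_bigr => k _; rewrite -sumrB.
by apply: eq_bigr => l _; rewrite !mxE.
Qed.

Lemma two_valuedE (R : realFieldType) d n (lambda : R) (L : 'M[R]_(d, n)) :
  (forall i j, L i j = 0 \/ L i j = lambda) ->
  L = two_valued_table lambda (fun i j => L i j != 0).
Proof.
move=> L2; apply/matrixP => i j; rewrite mxE.
by case: eqVneq => // /eqP; case: (L2 i j).
Qed.

(** * Part (1): tables with entries 0 and 1/m *)

Section LevelMatrix.
Variables (R : realFieldType) (d n m : nat) (S : 'I_d -> pred 'I_n).
Hypotheses (d_gt0 : (0 < d)%N) (m_gt0 : (0 < m)%N).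
Hypothesis sum_S : (\sum_i \sum_j S i j).+1 = (m * n)%N.
Hypothesis S_proper : forall i, exists j, ~~ S i j.

Let L : 'M[R]_(d, n) := two_valued_table m%:R^-1 S.
Let A := matrix_of_table L.

Let m_pos : 0 < m%:R :> R. Proof. by rewrite ltr0n. Qed.

Lemma level_table_weight : table_weight L = n%:R - m%:R^-1.
Proof.
have s1 : ((\sum_i \sum_j S i j)%:R + 1 = m%:R * n%:R :> R).
  by rewrite natr1 -natrM sum_S.
rewrite two_valued_weight -(mulr_natl _^-1); apply/eqP.
rewrite eq_sym subr_eq -[X in _ + X]mul1r -mulrDl s1.
by rewrite mulrAC mulfV ?lt0r_neq0 // mul1r.
Qed.

Lemma level_table_cover : hyperplane_cover A L.
Proof.
apply: two_valued_cover => // a.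
by rewrite /A matrix_of_two_valued.
Qed.

Lemma level_cover_weight (L' : 'M[R]_(d, n)) (t : nat) (a : Defs.index d n) :
  hyperplane_cover A L' -> (\sum_i S i (a i))%N = t -> (t < m)%N ->
  n%:R - (m - t)%:R^-1 * (1 - index_weight L' a) <= table_weight L'.
Proof.
move=> AL' sum_a t_lt.
have [K [Kdiag AK <-]] := polydiagonal_through R d_gt0 sum_S sum_a t_lt.
exact: polydiagonal_slack AL'.
Qed.

Lemma level_zero_index : exists a : Defs.index d n, forall i, ~~ S i (a i).
Proof.
have /fin_all_exists[f fS] := S_proper.
by exists [ffun i => f i] => i; rewrite ffunE.
Qed.

Lemma level_extremal : extremal R A.
Proof.
split=> [[K [Kdiag AK]]|a].
  have := polyplex_le_table_weight Kdiag AK level_table_cover.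
  by rewrite level_table_weight lerBrDr gerDl leNgt invr_gt0 m_pos.
rewrite /A matrix_of_two_valued // => /negbT; rewrite -ltnNge => t_lt.
have [K [Kdiag AK _]] := polydiagonal_through R d_gt0 sum_S erefl t_lt.
by exists K.
Qed.

Lemma level_deficiency : has_deficiency A (m%:R^-1 : R).
Proof.
exists (n%:R - m%:R^-1); split; last by rewrite opprB addrCA subrr addr0.
split=> [|W K KW AK]; last first.
  rewrite -level_table_weight.
  by rewrite (polyplex_le_table_weight KW AK level_table_cover).
have [a aS] := level_zero_index.
have sum_a : (\sum_i S i (a i) = 0)%N.
  by apply: big1 => i _; rewrite (negPf (aS i)).
have [K [Kdiag /subsetP AK Ka]] := polydiagonal_through R d_gt0 sum_S sum_a m_gt0.
rewrite subn0 in Ka; have [K_ge0 K_le1 K_sum] := Kdiag.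
(* Deleting the entry 1/m at [a] brings the polydiagonal back inside [A]. *)
exists [ffun b => if b == a then 0 else K b]; split; [split|] => [b|i j||].
- by rewrite ffunE; case: ifP.
- apply: le_trans (K_le1 i j); apply: ler_sum => b _.
  by rewrite ffunE; case: ifP.
- rewrite -K_sum [in RHS](bigD1 a) //= Ka addrAC subrr add0r.
  rewrite (bigD1 a) //= ffunE eqxx add0r; apply: eq_bigr => b /negPf ba.
  by rewrite ffunE ba.
apply/subsetP => b; rewrite !inE ffunE; case: (eqVneq b a) => [|ba Kb].
  by rewrite eqxx.
by have := AK b; rewrite !inE ffunE (negPf ba); apply.
Qed.

Lemma level_optimal : optimal_cover A L.
Proof.
split=> [|L' AL']; first exact: level_table_cover.
have [a aS] := level_zero_index.
have sum_a : (\sum_i S i (a i) = 0)%N.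
  by apply: big1 => i _; rewrite (negPf (aS i)).
rewrite level_table_weight; apply: le_trans (level_cover_weight AL' sum_a m_gt0).
have [L'_ge0 _] := AL'.
rewrite subn0 lerD2l lerN2 ler_piMr ?invr_ge0 ?ler0n // gerBl.
by apply: sumr_ge0.
Qed.

(** Optimality caps the weight of [L'] at [n - 1/m], so with [w] the weight of [a] in [L'] the loss
    [(1 - w) / (m - t)] is at least 1/m, that is, [w <= t / m]. *)
Lemma level_index_weight_le (L' : 'M[R]_(d, n)) (a : Defs.index d n) :
  optimal_cover A L' -> (\sum_i S i (a i) < m)%N ->
  index_weight L' a <= m%:R^-1 *+ (\sum_i S i (a i)).
Proof.
move=> [AL' L'_min]; set t := (\sum_i _)%N => t_lt.
have := le_trans (level_cover_weight AL' erefl t_lt) (L'_min _ level_table_cover).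
rewrite level_table_weight lerD2l lerN2 -/t.
rewrite ler_pdivlMl ?ltr0n ?subn_gt0 // natrB 1?ltnW // mulrBl.
rewrite mulfV ?lt0r_neq0 //.
by rewrite -(mulr_natl _^-1); lra.
Qed.

(** Changing one coordinate of an index [z] that avoids [S] isolates a single table entry. *)
Lemma level_optimal_unique (L' : 'M[R]_(d, n)) : optimal_cover A L' -> L' = L.
Proof.
move=> optL'; have [[L'_ge0 AL'] L'_min] := optL'.
have [z zS] := level_zero_index.
have zS0 i : (\sum_(l | l != i) S l (z l) = 0)%N.
  by apply: big1 => l _; rewrite (negPf (zS l)).
have sum_update i j : (\sum_l S l (update z i j l) = S i j)%N.
  by rewrite (big_update _ (fun l k => S l k : nat)) zS0 /= addn0.
have L'_le i j : (S i j < m)%N -> L' i j <= L i j.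
  rewrite -(sum_update i j) => /(level_index_weight_le optL').
  rewrite sum_update [L i j]mxE; apply: le_trans.
  by rewrite [leRHS]big_update lerDl sumr_ge0.
have [m_gt1|m_le1] := ltnP 1 m.
  (* For [m > 1] every modified index has fewer than [m] coordinates in [S], so [L' <= L]
     entrywise. *)
  apply: table_eq_of_le (proj2 level_optimal _ (proj1 optL')) => i j.
  by apply: L'_le; case: (S i j); rewrite // ltnW.
have m1 : m = 1%N by apply/eqP; rewrite eqn_leq m_le1.
(* For [m = 1] the comparison is reversed: an index through an entry of [S] lies in [A], and its
   other coordinates weigh 0 in [L']. *)
apply/esym/table_eq_of_le => [i j|]; last exact: L'_min level_table_cover.
rewrite mxE; have [Sij|nSij] := boolP (S i j); last exact: L'_ge0.
have : 1 <= index_weight L' (update z i j).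
  by apply: AL'; rewrite inE /A matrix_of_two_valued // sum_update Sij m1.
rewrite /index_weight big_update m1 invr1 mulr1n big1 /= ?addr0 // => l _.
apply/le_anti; rewrite L'_ge0 andbT; apply: le_trans (L'_le _ _ _) _.
  by rewrite (negPf (zS l)).
by rewrite mxE (negPf (zS l)).
Qed.

End LevelMatrix.

(** * Part (2): extremal matrices with a two-valued optimal cover *)

Section TwoValuedOptimalCover.
Variables (R : realFieldType) (d n : nat).
Hypothesis d_gt0 : (0 < d)%N.
Variables (A : zero_one_matrix d n) (L : 'M[R]_(d, n)).
Hypotheses (A_extremal : extremal R A) (L_optimal : optimal_cover A L).

Lemma extremal_cover_weight_lt : table_weight L < n%:R.
Proof.
have [noK _] := A_extremal; have [_ L_min] := L_optimal.
have [//|[L' [AL' L'n]]] := polydiagonal_or_light_cover R A d_gt0.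
exact: le_lt_trans (L_min _ AL') L'n.
Qed.

(** Otherwise nothing is lost at [a], and the polydiagonal created by adding [a] forces [L] to weigh
    at least [n]. *)
Lemma extremal_index_weight_lt1 a : A a = false -> index_weight L a < 1.
Proof.
have [_ addK] := A_extremal => /addK[K [Kdiag AK]].
have [[K_ge0 _ _] [AL _]] := (Kdiag, L_optimal).
rewrite ltNge; apply/negP => La.
have := polydiagonal_slack Kdiag AK AL; have := extremal_cover_weight_lt.
suff : K a * (1 - index_weight L a) <= 0 by lra.
by rewrite mulr_ge0_le0 // subr_le0.
Qed.

Lemma extremal_eq_matrix_of_table : A = matrix_of_table L.
Proof.
apply/ffunP => a; rewrite ffunE; case Aa : (A a).
  by have [[_ AL] _] := L_optimal; rewrite AL // inE.
by apply/esym/negbTE; rewrite -ltNge; exact: extremal_index_weight_lt1.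
Qed.

Lemma extremal_cover_weight_ge a :
  A a = false -> n%:R - (1 - index_weight L a) <= table_weight L.
Proof.
move=> Aa; have La := extremal_index_weight_lt1 Aa.
have [_ /(_ a Aa)[K [Kdiag AK]]] := A_extremal.
have [AL _] := L_optimal; apply: le_trans (polydiagonal_slack Kdiag AK AL).
rewrite lerD2l lerN2 ler_piMl //; first by rewrite subr_ge0 ltW.
exact: polyplex_entry_le1 d_gt0 Kdiag.
Qed.

(** The zero table covers an empty support, and a polydiagonal on a single index forces [n <= 1].
    Here [lambda] is not an entry of [L], whence the guard [1 < n] in the theorem. *)
Lemma extremal_empty :
  (forall a, A a = false) -> n = 1%N /\ L = 0.
Proof.
move=> A0; have [[L_ge0 _] L_min] := L_optimal.
have wL0 : table_weight (0 : 'M[R]_(d, n)) = 0.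
  by apply: big1 => i _; apply: big1 => j _; rewrite mxE.
have L0 : L = 0.
  apply/esym/table_eq_of_le => [i j|]; first by rewrite mxE.
  by apply: L_min; split=> [i j|a]; rewrite ?mxE // inE A0.
split=> //; have := extremal_cover_weight_lt; rewrite L0 wL0 ltr0n => n_gt0.
have := extremal_cover_weight_ge (A0 [ffun=> Ordinal n_gt0]).
rewrite L0 wL0 /index_weight big1 => [|i _]; last by rewrite mxE.
by rewrite subr0 subr_le0 lern1 => n_le1; apply/eqP; rewrite eqn_leq n_le1.
Qed.

Variable lambda : R.
Hypothesis lambda_gt0 : 0 < lambda.
Hypothesis L_two_valued : forall i j, L i j = 0 \/ L i j = lambda.

Let S i j := L i j != 0.

Lemma extremal_two_valued a0 :
  A a0 ->
  exists m : nat, [/\ (0 < m)%N, lambda = m%:R^-1,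
    table_weight L = n%:R - m%:R^-1 & forall i, exists j, L i j = 0].
Proof.
move=> Aa0; have LE : L = two_valued_table lambda S := two_valuedE L_two_valued.
have [[L_ge0 AL] L_min] := L_optimal.
pose c (a : Defs.index d n) := (\sum_i S i (a i))%N.
have [b Ab b_min] := arg_minnP c Aa0.
set m := c b in b_min; set s := (\sum_i \sum_j S i j)%N.
have wL : table_weight L = lambda *+ s by rewrite {1}LE two_valued_weight.
have wc a : index_weight L a = lambda *+ c a.
  by rewrite {1}LE two_valued_index_weight.
have wLn := extremal_cover_weight_lt.
have lm_ge1 : 1 <= lambda *+ m.
  by rewrite -wc; apply: AL; rewrite inE.
have m_gt0 : (0 < m)%N.
  by rewrite lt0n; apply: contraTneq lm_ge1 => ->; rewrite mulr0n ler10.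
have [i0 Si0] : exists i, S i (b i).
  apply/existsP; apply: contraLR m_gt0; rewrite negb_exists => /forallP bS.
  by rewrite -eqn0Ngt; apply/eqP; apply: big1 => i _; rewrite (negPf (bS i)).
have s_gt0 : (0 < s)%N.
  by rewrite /s (bigD1 i0) //= (bigD1 (b i0)) //= Si0.
have m_pos : 0 < m%:R :> R by rewrite ltr0n.
have lE : lambda = m%:R^-1.
  (* Covering [b] gives [lambda >= 1/m]; optimality against the table 1/m on [S] gives the
     converse. *)
  apply/eqP; rewrite eq_le; apply/andP; split; last first.
    by rewrite -[leLHS]mul1r ler_pdivrMr // mulr_natr.
  have := L_min _ (two_valued_cover R m_gt0 b_min).
  by rewrite wL two_valued_weight ler_pMn2r.
have wLs : table_weight L = s%:R / m%:R by rewrite wL lE mulr_natl.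
have s_lt : (s < m * n)%N.
  by rewrite -(ltr_nat R) natrM -ltr_pdivrMl // mulrC -wLs.
have rows_zero i : exists j, L i j = 0.
  have [/existsP[j /eqP Lij]|] := boolP [exists j, L i j == 0]; first by exists j.
  rewrite negb_exists => /forallP Si; exfalso.
  (* Dropping a full row [i] lowers every [c a] by one and [s] by [n]. Optimality against 1/(m - 1)
     on [S'] would give [s >= m * n]; for [m = 1], already [s >= n]. *)
  pose S' l j := (l != i) && S l j.
  have cS' a : (c a = 1 + \sum_l S' l (a l))%N.
    rewrite /c (bigD1 i) //= {1}/S Si; congr (_ + _)%N.
    by rewrite big_mkcond; apply: eq_bigr => l _; rewrite /S'; case: eqP.
  have sS' : (s = n + \sum_l \sum_j S' l j)%N.
    rewrite /s (bigD1 i) //=; congr (_ + _)%N.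
      under eq_bigr do rewrite /S Si.
      by rewrite sum1_card card_ord.
    rewrite big_mkcond; apply: eq_bigr => l _; rewrite /S'; case: eqP => //= _.
    by rewrite big1.
  case: (posnP m.-1) => [m1|q_gt0].
    move: s_lt sS'; have -> : m = 1%N by lia.
    by move=> + sE; rewrite mul1n sE ltnNge leq_addr.
  have AS' a : A a -> (m.-1 <= \sum_l S' l (a l))%N.
    by move=> /b_min; rewrite [c a]cS' -subn1 leq_subLR.
  have := L_min _ (two_valued_cover R q_gt0 AS').
  rewrite wLs two_valued_weight -(mulr_natl _^-1) ler_pdivrMr // mulrAC.
  rewrite ler_pdivlMr ?ltr0n // -!natrM ler_nat.
  move: s_lt sS' m_gt0; clearbody m s; move: (\sum_l _)%N => s'; nia.
(* Moving [b] out of [S] in direction [i0] leaves [m - 1] coordinates in [S], so by minimality the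
   new index is outside [A]. *)
exists m; split=> //; have [j0 Lj0] := rows_zero i0.
have Si0j0 : S i0 j0 = false by rewrite /S Lj0 eqxx.
have c_upd : (m = 1 + c (update b i0 j0))%N.
  rewrite /c (big_update _ (fun l k => S l k : nat)) Si0j0 /=.
  by rewrite /m /c (bigD1 i0) //= Si0.
have /extremal_cover_weight_ge : A (update b i0 j0) = false.
  by apply: contraTF isT => /b_min; rewrite c_upd; lia.
rewrite wc; have -> : lambda *+ c (update b i0 j0) = 1 - m%:R^-1.
  apply/eqP; rewrite eq_sym subr_eq -lE -mulrSr -add1n -c_upd lE.
  by rewrite -(mulr_natl _^-1) mulfV ?lt0r_neq0.
(* The upper bound is integrality: [s < m * n] means [s + 1 <= m * n]. *)
rewrite subKr => wL_ge; apply/eqP; rewrite eq_le wL_ge andbT.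
rewrite wLs ler_pdivrMr // mulrBl mulVf ?lt0r_neq0 //.
rewrite lerBrDr natr1 -natrM ler_nat.
by rewrite mulnC.
Qed.

End TwoValuedOptimalCover.

(** * The two directions together *)

Theorem theorem6p6 (R : realFieldType) (d n : nat) (hd : (0 < d)%N) :
  (forall (m : nat) (L : 'M[R]_(d, n)),
      (0 < m)%N ->
      nonneg_table L ->
      (forall i j, L i j = 0 \/ L i j = m%:R^-1) ->
      table_weight L = n%:R - m%:R^-1 ->
      (forall i, exists j, L i j = 0) ->
      [/\ extremal R (matrix_of_table L),
          has_deficiency (matrix_of_table L) (m%:R^-1 : R),
          optimal_cover (matrix_of_table L) L
        & forall L' : 'M[R]_(d, n),
            optimal_cover (matrix_of_table L) L' -> L' = L])
  /\
  (forall (A : zero_one_matrix d n) (L : 'M[R]_(d, n)) (lambda : R),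
      extremal R A ->
      optimal_cover A L ->
      0 < lambda ->
      (forall i j, L i j = 0 \/ L i j = lambda) ->
      exists m : nat,
        (0 < m)%N /\
        ((1 < n)%N -> lambda = m%:R^-1) /\
        (forall i j, L i j = 0 \/ L i j = m%:R^-1) /\
        table_weight L = n%:R - m%:R^-1 /\
        (forall i, exists j, L i j = 0) /\
        A = matrix_of_table L).
Proof.
split=> [m L m_gt0 _ L2 wL rows_zero|A L lambda extA optL lambda_gt0 L2].
  have LE := two_valuedE L2; set S := fun i j => _ in LE.
  have S_proper i : exists j, ~~ S i j.
    by have [j Lij] := rows_zero i; exists j; rewrite /S Lij eqxx.
  have m_pos : 0 < m%:R :> R by rewrite ltr0n.
  have sum_S : ((\sum_i \sum_j S i j).+1 = m * n)%N.
    apply/eqP; rewrite -(eqr_nat R) -natr1 natrM; apply/eqP.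
    move: wL; rewrite {1}LE two_valued_weight -(mulr_natl _^-1).
    move=> /(congr1 ( *%R^~ m%:R)); rewrite mulfVK ?lt0r_neq0 // mulrBl.
    by rewrite mulVf ?lt0r_neq0 // => ->; rewrite subrK mulrC.
  clearbody S; subst L; split.
  - exact: level_extremal.
  - exact: level_deficiency.
  - exact: level_optimal.
  - exact: level_optimal_unique.
have AE := extremal_eq_matrix_of_table hd extA optL.
have [a0 Aa0|A0] := pickP A.
  have [m [m_gt0 lE wL rows_zero]] :=
    extremal_two_valued hd extA optL lambda_gt0 L2 Aa0.
  by exists m; do !split=> //; rewrite -lE.
have [n1 L0] := extremal_empty hd extA optL A0.
(* With [n = 1] and [L = 0], the weight 0 is [n - 1/m] for [m = 1]. *)
exists 1%N; split=> //; split=> [|]; first by rewrite n1.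
split=> [i j|]; first by left; rewrite L0 mxE.
split; last split=> // i.
  have -> : table_weight L = 0.
    by rewrite L0; apply: big1 => i _; apply: big1 => j _; rewrite mxE.
  by rewrite invr1 n1 subrr.
have n_gt0 : (0 < n)%N by rewrite n1.
by exists (Ordinal n_gt0); rewrite L0 mxE.
Qed.
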